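(* For every $a,b\in\mathbb{R}$ with $0<a<b$ there exist two distinct probability measures $\mu_1$ and $\mu_2$ with support $[a,b]$ and $C^\infty$ densities $f_1$ and $f_2$ for which infinitely many moments agree, i.e. $s_k(\mu_1)=s_k(\mu_2)$ for infinitely many $k\in\mathbb{N}$.
   Context: $\mathbb{N}=\{0,1,2,\dots\}$. The moments of $\mu$ are $s_k(\mu)=\int_0^\infty t^k\,d\mu(t)$, $k\in\mathbb{N}$. Densities are with respect to Lebesgue measure and are $C^\infty$ functions on $\mathbb{R}$. *)

(* Defs.v *)
From mathcomp Require Export all_boot all_order all_algebra.
From mathcomp Require Export all_classical all_reals all_analysis.
Import Order.TTheory GRing.Theory Num.Theory.
Import numFieldNormedType.Exports.

Set Implicit Arguments.
Unset Strict Implicit.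
Unset Printing Implicit Defensive.

Local Open Scope classical_set_scope.
Local Open Scope ring_scope.
Local Open Scope ereal_scope.

(* [derive1n] is a total operator, so the existence of each derivative has to be
   asserted; continuity of the derivatives is then automatic. *)
Definition smooth (R : realType) (f : R -> R) : Prop :=
  forall (n : nat) (x : R), derivable (derive1n n f) x 1%R.

Definition msupport (R : realType)
    (mu : {measure set (measurableTypeR R) -> \bar R}) : set R :=
  [set x | forall U : set R, open U -> U x -> 0 < mu U].

(* [f] is a density of [mu] with respect to Lebesgue measure. *)
Definition has_density (R : realType)
    (mu : {measure set (measurableTypeR R) -> \bar R}) (f : R -> R) : Prop :=
  (forall x, (0 <= f x)%R) /\
  forall A : set (measurableTypeR R), measurable A ->
    mu A = \int[lebesgue_measure]_(x in A) (f x)%:E.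

Definition moment (R : realType)
    (mu : {measure set (measurableTypeR R) -> \bar R}) (k : nat) : \bar R :=
  \int[mu]_(t in `[0%R, +oo[) (t ^+ k)%:E.

(* Main.v *)
Require Import Defs.
From HB Require Import structures.
From mathcomp Require Import measurable_realfun.
From mathcomp Require Import ring lra.

(** Let g be the standard bump function, positive exactly on ]a, b[, and Z its
    integral. It suffices to find a smooth bounded function h <> 0, supported in
    a compact subinterval of ]a, b[, with zero integral and infinitely many zero
    moments: for small e > 0 the densities g / Z and g / Z + e h are then positive
    exactly on ]a, b[, have mass 1, define distinct measures, and have the same
    moment of order k whenever the moment of h of order k vanishes.

    The function h ([smooth_vanishing_moments]) comes from dilations. If q > 1 and
    c = q^-(k+1), then f(x) - c f(x / q) has zero moment of order k, because the
    dilation multiplies this moment by q^(k+1). Moreover the operator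
    f |-> f - c f(. / q), for any c, preserves the vanishing of all other moments
    ([moment_primitive_dilate]). Ratios q_n with convergent product keep the
    supports in a fixed interval; once they are chosen, exponents k_n large enough
    make the coefficients c_n as small as desired, in particular summable. Since
    q_n >= 1, the perturbations at step n are small for all derivatives at once,
    so applying the operators one after the other to a smooth compactly supported
    psi converges to a smooth function ([dilation_limit_derive]), whose moments of
    order k_n all vanish. It is not zero because it remains close to psi
    ([dilation_limit_dist]), and its integral is zero because psi is chosen to be
    the derivative of a bump function. *)

Import Order.TTheory GRing.Theory Num.Theory.
Import numFieldNormedType.Exports.

Set Implicit Arguments.
Unset Strict Implicit.
Unset Printing Implicit Defensive.

Local Open Scope classical_set_scope.
Local Open Scope ring_scope.

(** * Derivatives through quadratic estimates *)

(** A quadratic error term is an existence criterion for the derivative that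
    is closed under pointwise limits; it replaces uniform convergence of the
    derivatives in [is_derive_lim] and also handles the flat point of [flat]. *)
Lemma is_derive_quadratic (R : realType) (f : R -> R) (x d K : R) :
  (forall y, `|f y - f x - (y - x) * d| <= K * (y - x) ^+ 2) ->
  is_derive x 1 f d.
Proof.
move=> H.
have K0 : 0 <= K.
  by have := le_trans (normr_ge0 _) (H (x + 1)); rewrite addrC addKr expr1n mulr1.
have cv : h^-1 *: (f (h *: 1 + x) - f x) @[h --> 0^'] --> d.
  apply/cvgrPdist_le => e e0.
  near=> h.
  have h0 : h != 0 by near: h; exact: nbhs_dnbhs_neq.
  rewrite distrC.
  have -> : h^-1 *: (f (h *: 1 + x) - f x) - d
      = h^-1 * (f (h + x) - f x - ((h + x) - x) * d).
    by rewrite /GRing.scale/= mulr1; field.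
  rewrite normrM normfV ler_pdivrMl ?normr_gt0//.
  apply: le_trans (H _) _.
  rewrite addrK -real_normK ?num_real// expr2 mulrA mulrC ler_wpM2l//.
  have : `|h| <= e / (K + 1).
    near: h; apply: dnbhs0_le; rewrite divr_gt0//; lra.
  rewrite ler_pdivlMr; last lra.
  move=> hle; apply: le_trans hle; rewrite mulrC ler_wpM2l//; lra.
apply: DeriveDef; first by apply/cvg_ex; exists d.
by apply/cvg_lim.
Unshelve. all: by end_near. Qed.

Lemma derivable_continuous (R : realType) (f f1 : R -> R) :
  (forall x : R, is_derive x 1 f (f1 x)) -> continuous f.
Proof.
move=> H x; apply: differentiable_continuous.
apply/derivable1_diffP; exact: (@ex_derive _ _ _ _ _ _ _ (H x)).
Qed.

Lemma MVT_dist (R : realType) (f f1 : R -> R) (x y : R) :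
  (forall x : R, is_derive x 1 f (f1 x)) ->
  exists2 c, `|c - x| <= `|y - x| & f y - f x = f1 c * (y - x).
Proof.
move=> H.
have cf A : {within A, continuous f}.
  by apply: continuous_subspaceT; exact: derivable_continuous H.
case: (leP x y) => xy.
  have [c] := MVT_segment xy (fun z _ => H z) (cf _).
  rewrite in_itv/= => /andP[xc cy] E; exists c => //.
  by rewrite !ger0_norm ?subr_ge0// lerD2r.
have [c] := MVT_segment (ltW xy) (fun z _ => H z) (cf _).
rewrite in_itv/= => /andP[yc cx] E; exists c => //.
  by rewrite !ler0_norm ?subr_le0 ?(ltW xy)// lerN2 lerD2r.
by rewrite -opprB E; ring.
Qed.

Lemma taylor_quadratic (R : realType) (f f1 f2 : R -> R) (K : R) :
  (forall x : R, is_derive x 1 f (f1 x)) ->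
  (forall x : R, is_derive x 1 f1 (f2 x)) ->
  (forall x, `|f2 x| <= K) ->
  forall x y, `|f y - f x - (y - x) * f1 x| <= K * (y - x) ^+ 2.
Proof.
move=> H1 H2 HK x y.
have [c cx ->] := MVT_dist x y H1.
have [d _ E] := MVT_dist x c H2.
have -> : f1 c * (y - x) - (y - x) * f1 x = (f1 c - f1 x) * (y - x) by ring.
rewrite E !normrM -(real_normK (num_real (y - x))) expr2 mulrA.
rewrite ler_wpM2r// ler_pM//.
Qed.

(** The second derivatives share the bound [K], so all the [G n] satisfy the
    same quadratic estimate, which survives the pointwise limit. *)
Lemma is_derive_lim (R : realType) (G G1 G2 : nat -> R -> R) (g g1 : R -> R)
    (K : R) :
  (forall n (x : R), is_derive x 1 (G n) (G1 n x)) ->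
  (forall n (x : R), is_derive x 1 (G1 n) (G2 n x)) ->
  (forall n x, `|G2 n x| <= K) ->
  (forall x, G n x @[n --> \oo] --> g x) ->
  (forall x, G1 n x @[n --> \oo] --> g1 x) ->
  forall x : R, is_derive x 1 g (g1 x).
Proof.
move=> H1 H2 HK cG cG1 x; apply: (@is_derive_quadratic _ _ _ _ K) => y.
have cv : `|G n y - G n x - (y - x) * G1 n x| @[n --> \oo] -->
    `|g y - g x - (y - x) * g1 x|.
  apply: cvg_norm; apply: cvgB; first by apply: cvgB; [exact: cG|exact: cG].
  by apply: cvgM; [exact: cvg_cst|exact: cG1].
rewrite -(cvg_lim _ cv)//; apply: limr_le; first by apply/cvg_ex; eexists; exact: cv.
by apply: nearW => n; apply: (taylor_quadratic (H1 n) (H2 n)).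
Qed.

(** * Functions with bounded derivatives and bump functions *)

(** Boundedness of every derivative is carried along with differentiability:
    the products and affine changes of variable below then need no compactness
    argument to provide the bounds on which the limit process relies. *)
Fixpoint bounded_diff (R : realType) (n : nat) (f : R -> R) : Prop :=
  (exists M : R, forall x, `|f x| <= M) /\
  if n is m.+1 then
    exists2 f1 : R -> R, (forall x : R, is_derive x 1 f (f1 x)) & bounded_diff m f1
  else True.

Section bounded_diff.
Context {R : realType}.
Implicit Types (f g : R -> R) (n : nat) (c : R).

Lemma bounded_diff_bound n f :
  bounded_diff n f -> exists M, forall x, `|f x| <= M.
Proof. by case: n => [|n] []. Qed.

Lemma bounded_diffW n f : bounded_diff n.+1 f -> bounded_diff n f.
Proof.
elim: n f => [|n IH] f [Bf [f1 df bf]]; split => //.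
by exists f1 => //; exact: IH.
Qed.

Lemma bounded_diffD n f g :
  bounded_diff n f -> bounded_diff n g -> bounded_diff n (f \+ g).
Proof.
elim: n f g => [|n IH] f g [[M HM] Hf] [[N HN] Hg]; split => //.
1,2: by exists (M + N) => x; rewrite (le_trans (ler_normD _ _))// lerD.
case: Hf => f1 df bf; case: Hg => g1 dg bg.
exists (f1 \+ g1); last exact: IH.
by move=> x; apply: is_deriveD.
Qed.

Lemma bounded_diffM n f g :
  bounded_diff n f -> bounded_diff n g -> bounded_diff n (f \* g).
Proof.
elim: n f g => [|n IH] f g Bf Bg.
  move: Bf Bg => [[M HM] Hf] [[N HN] Hg]; split => //.
  by exists (M * N) => x; rewrite normrM ler_pM.
have := bounded_diffW Bf; have := bounded_diffW Bg.
move: Bf Bg => [[M HM] [f1 df bf]] [[N HN] [g1 dg bg]] Bf Bg; split.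
  by exists (M * N) => x; rewrite normrM ler_pM.
exists ((f \* g1) \+ (g \* f1)).
  by move=> x; apply: is_deriveM.
by apply: bounded_diffD; exact: IH.
Qed.

Lemma bounded_diff_cst n c : bounded_diff n (fun=> c).
Proof.
elim: n c => [|n IH] c; split => //.
1,2: by exists `|c|.
by exists (fun=> 0) => // x; exact: is_derive_cst.
Qed.

Lemma bounded_diffZ n f c :
  bounded_diff n f -> bounded_diff n (fun x => c * f x).
Proof.
by move=> Hf; apply: (@bounded_diffM n (fun=> c)) => //; exact: bounded_diff_cst.
Qed.

Lemma is_derive_affine f f1 (p r x : R) :
  (forall x : R, is_derive x 1 f (f1 x)) ->
  is_derive x 1 (fun x => f (p * x + r)) (p * f1 (p * x + r)).
Proof.
move=> df.
have d1 : is_derive x 1 (fun x : R => p * x + r) p.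
  by apply: is_derive_eq; rewrite /GRing.scale/= ?mulr1 ?addr0 ?mulr0 ?addr0.
have d2 := df (p * x + r).
have -> : (fun x => f (p * x + r)) = f \o (fun x : R => p * x + r) by [].
by apply: is_derive_eq; rewrite /GRing.scale/= mulrC.
Qed.

Lemma bounded_diff_affine n f (p r : R) :
  bounded_diff n f -> bounded_diff n (fun x => f (p * x + r)).
Proof.
elim: n f => [|n IH] f [[M HM] Hf]; split => //.
1,2: by exists M.
case: Hf => f1 df bf.
exists (fun x => p * f1 (p * x + r)); last exact/bounded_diffZ/IH.
by move=> x; exact: is_derive_affine.
Qed.

Lemma bounded_diff_smooth f : (forall n, bounded_diff n f) -> smooth f.
Proof.
move=> Hf n; elim: n f Hf => [|n IH] f Hf x.
  by case: (Hf 1%N) => _ [f1 df _]; exact: ex_derive.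
rewrite derive1Sn; apply: IH => m.
case: (Hf m.+1) => _ [f1 df bf].
suff -> : f^`()%classic = f1 by [].
by apply/funext => y; rewrite derive1E; exact: derive_val.
Qed.

Lemma smooth_is_derive f n (x : R) : smooth f ->
  is_derive x 1 (f^`(n)%classic) (f^`(n.+1)%classic x).
Proof.
by move=> sf; rewrite derive1nS derive1E; apply: DeriveDef; first exact: sf.
Qed.

Lemma smooth_continuous f : smooth f -> continuous f.
Proof.
move=> sf; apply: (@derivable_continuous _ f (f^`(1))%classic) => x.
exact: (smooth_is_derive 0 x sf).
Qed.

Lemma bounded_diff_derive1n m f : (forall n, bounded_diff n f) ->
  forall n, bounded_diff n (f^`(m)%classic).
Proof.
elim: m f => [//|m IH] f Hf n; rewrite derive1Sn; apply: IH => {}n.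
case: (Hf n.+1) => _ [f1 df bf].
suff -> : f^`()%classic = f1 by [].
by apply/funext => y; rewrite derive1E; exact: derive_val.
Qed.

(** Smoothness of a function given together with candidates for all its
    derivatives, as happens for limits and linear combinations. *)
Lemma family_smooth (F : nat -> R -> R) :
  (forall m (x : R), is_derive x 1 (F m) (F m.+1 x)) -> smooth (F 0%N).
Proof.
move=> dF n x.
suff -> : derive1n n (F 0%N) = F n by exact: ex_derive.
elim: n => [//|n IH]; rewrite derive1nS IH.
by apply/funext => y; rewrite derive1E; exact: derive_val.
Qed.

End bounded_diff.

(** The functions x^-k exp(-1/x) on the positive axis, extended by 0: up to
    linear combinations this family is stable under differentiation, so that no
    polynomial in 1/x has to be tracked. *)
Definition flat (R : realType) (k : nat) (x : R) : R :=
  if 0 < x then x ^- k * expR (- x^-1) else 0.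

Section flat.
Context {R : realType}.
Implicit Types (x y : R) (k n : nat).

Lemma exprn_le_expR k y : 0 < y -> y ^+ k <= k`!%:R * expR y.
Proof.
move=> y0; case: k => [|k].
  by rewrite expr0 fact0 mul1r ltW// expR_gt1.
have H := expR_ge1Dxn k (ltW y0).
have f0 : 0 < (k.+1)`!%:R :> R by rewrite ltr0n fact_gt0.
by rewrite mulrC -ler_pdivrMr//; apply: le_trans H; rewrite lerDr.
Qed.

Lemma flat_bound k x : `|flat k x| <= k`!%:R.
Proof.
rewrite /flat; case: ltP => x0; last by rewrite normr0.
rewrite ger0_norm; last first.
  by rewrite mulr_ge0 ?expR_ge0 ?invr_ge0 ?exprn_ge0 ?ltW.
rewrite expRN -(exprVn x) ler_pdivrMr ?expR_gt0//.
by apply: exprn_le_expR; rewrite invr_gt0.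
Qed.

Lemma flat_shift k n x : x ^+ n * flat (n + k) x = flat k x.
Proof.
rewrite /flat; case: ltP => x0; last by rewrite mulr0.
rewrite exprD invfM !mulrA divff ?mul1r// expf_neq0// gt_eqF//.
Qed.

(** At the origin, [flat_shift] rewrites the function as x^2 times a bounded one,
    so the quadratic criterion applies with derivative 0. *)
Lemma is_derive_flat k x :
  is_derive x 1 (flat k) (flat k.+2 x - k%:R * flat k.+1 x).
Proof.
case: (ltgtP x 0) => [x0|x0|->].
- have -> : flat k.+2 x - k%:R * flat k.+1 x = 0.
    by rewrite /flat ltNge (ltW x0)/= mulr0 subr0.
  apply: (@near_eq_is_derive _ _ _ (cst 0)) => //.
  near=> z; rewrite /flat ltNge ifF//=; apply/negbF/ltW.
  by near: z; exact: lt_nbhsl.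
- rewrite /flat x0.
  apply: (@near_eq_is_derive _ _ _ (fun z : R => z ^- k * expR (- z^-1))).
  + by near=> z; rewrite ifT//; near: z; exact: lt_nbhsr.
  + have xn0 : x != 0 by rewrite gt_eqF.
    have dV : is_derive x 1 (fun z : R => z^-1) (- x ^- 2).
      apply: is_derive_eq; first exact: (is_deriveV (f := id)).
      by rewrite /GRing.scale/= mulr1.
    have dE : is_derive x 1 (fun z : R => expR (- z^-1))
        (expR (- x^-1) * x ^- 2).
      have dN : is_derive x 1 (fun z : R => - z^-1) (x ^- 2).
        by rewrite -[x ^- 2]opprK; apply: is_deriveN.
      exact: (is_derive1_comp (f := expR)).
    have dX : is_derive x 1 (fun z : R => z ^- k) (- (k%:R * x ^- k.+1)).
      have -> : (fun z : R => z ^- k) = (fun z : R => z^-1) ^+ k.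
        by apply/funext => z; rewrite exprfctE exprVn.
      apply: is_derive_eq; rewrite /GRing.scale/=.
      case: k => [|k]; first by rewrite !mul0r oppr0.
      by rewrite mulrN -!exprVn -mulrA -exprD addn2.
    apply: is_derive_eq; rewrite /GRing.scale/=.
    rewrite -!exprVn !exprS; ring.
- apply: (@is_derive_quadratic _ _ _ _ (k.+2)`!%:R) => y.
  rewrite /flat ltxx mulr0 !subr0 !mulr0 subr0 -/(flat k y).
  rewrite -(flat_shift k 2) normrM [leRHS]mulrC (ger0_norm (sqr_ge0 y)).
  by rewrite ler_wpM2l ?sqr_ge0// flat_bound.
Unshelve. all: by end_near. Qed.

Lemma bounded_diff_flat n k : bounded_diff n (@flat R k).
Proof.
have B j : exists M : R, forall x, `|flat j x| <= M.
  by exists (j`!%:R) => x; exact: flat_bound.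
elim: n k => [|n IH] k; split => //.
exists (fun x => flat k.+2 x - k%:R * flat k.+1 x); first exact: is_derive_flat.
have -> : (fun x => flat k.+2 x - k%:R * flat k.+1 x) =
  (flat k.+2 \+ (fun x => (- k%:R) * flat k.+1 x)).
  by apply/funext => x /=; rewrite mulNr.
by apply: bounded_diffD; [exact: IH|exact/bounded_diffZ/IH].
Qed.

Lemma flat_ge0 k x : 0 <= flat k x.
Proof.
rewrite /flat; case: ltP => // x0.
by rewrite mulr_ge0 ?expR_ge0 ?invr_ge0 ?exprn_ge0 ?ltW.
Qed.

Lemma flat_gt0 k x : 0 < x -> 0 < flat k x.
Proof.
by move=> x0; rewrite /flat x0 mulr_gt0 ?expR_gt0 ?invr_gt0 ?exprn_gt0.
Qed.

Lemma flat_le0 k x : x <= 0 -> flat k x = 0.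
Proof. by rewrite /flat ltNge => ->. Qed.

Lemma le_flat0 x y : x <= y -> flat 0 x <= flat 0 y.
Proof.
case: (ltP 0 x) => [x0 xy|x0 _]; last by rewrite (flat_le0 _ x0) flat_ge0.
have y0 := lt_le_trans x0 xy.
by rewrite /flat x0 y0 !expr0 invr1 !mul1r ler_expR lerN2 lef_pV2.
Qed.

End flat.

Definition bump (R : realType) (a b x : R) : R :=
  flat 0 (x - a) * flat 0 (b - x).

Section bump.
Context {R : realType}.
Implicit Types a b x : R.

Lemma bounded_diff_bump a b n : bounded_diff n (bump a b).
Proof.
have -> : bump a b =
    (fun x => flat 0 (1 * x + (- a))) \* (fun x => flat 0 ((-1) * x + b)).
  by apply/funext => x /=; rewrite /bump mul1r mulN1r (addrC (- x)).
by apply: bounded_diffM; apply: bounded_diff_affine; exact: bounded_diff_flat.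
Qed.

Lemma bump_ge0 a b x : 0 <= bump a b x.
Proof. by rewrite mulr_ge0 ?flat_ge0. Qed.

Lemma bump_gt0 a b x : a < x -> x < b -> 0 < bump a b x.
Proof. by move=> ax xb; rewrite mulr_gt0 ?flat_gt0 ?subr_gt0. Qed.

Lemma bump_left a b x : x <= a -> bump a b x = 0.
Proof. by move=> xa; rewrite /bump flat_le0 ?mul0r// subr_le0. Qed.

Lemma bump_right a b x : b <= x -> bump a b x = 0.
Proof. by move=> xa; rewrite /bump (flat_le0 _ (x := b - x)) ?mulr0// subr_le0. Qed.

(** This is the room available for a perturbation supported in [c, d]. *)
Lemma bump_minorant a b c d x : c <= x -> x <= d ->
  flat 0 (c - a) * flat 0 (b - d) <= bump a b x.
Proof.
by move=> cx xd; rewrite ler_pM ?flat_ge0 ?le_flat0// ?lerD2r// lerD2l lerN2.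
Qed.

End bump.

(** * Iterated dilation differences *)

Lemma cvg_halving (R : realType) (u : nat -> R) (C : R) :
  (forall n, `|u n.+1 - u n| <= C * 2^-1 ^+ n.+1) ->
  cvgn u /\ `|limn u - u 0%N| <= C.
Proof.
move=> H.
have dist n : `|u n - u 0%N| <= C * (1 - 2^-1 ^+ n).
  elim: n => [|n IH]; first by rewrite !subrr normr0 mulr0.
  rewrite (_ : u n.+1 - u 0%N = (u n.+1 - u n) + (u n - u 0%N)); last ring.
  apply: (le_trans (ler_normD _ _)); apply: (le_trans (lerD (H n) IH)).
  by rewrite exprS le_eqVlt; apply/orP; left; apply/eqP; field.
have C0 : 0 <= C.
  have := le_trans (normr_ge0 _) (H 0%N).
  by rewrite expr1 pmulr_lge0 ?invr_gt0.
have cu : cvgn u.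
  have -> : u = (fun n => u 0%N + series (telescope u) n).
    by apply/funext => n; rewrite -eq_sum_telescope.
  apply: is_cvgD; first exact: is_cvg_cst.
  apply: normed_cvg.
  apply: (@series_le_cvg _ _ (geometric (C / 2) 2^-1)).
  - by move=> n; exact: normr_ge0.
  - by move=> n; rewrite geometric_ge0 ?divr_ge0 ?invr_ge0.
  - by move=> n; rewrite /telescope /geometric/= (le_trans (H n))// exprS mulrA.
  - apply: is_cvg_geometric_series.
    by rewrite ger0_norm ?invr_ge0// invf_lt1// ltr1n.
split=> //.
have cv : `|u n - u 0%N| @[n --> \oo] --> `|limn u - u 0%N|.
  by apply: cvg_norm; apply: cvgB => //; exact: cvg_cst.
rewrite -(cvg_lim _ cv)//; apply: limr_le; first by apply/cvg_ex; eexists; exact: cv.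
apply: nearW => n; apply: (le_trans (dist n)); rewrite ler_piMr// lerBlDr lerDl.
Qed.

(** The function obtained from [psi] by applying in turn, for i < n, the
    operators f |-> f - c_i f(x / q_i), differentiated m times. The derivatives
    are written out because q_i >= 1 makes the bounds on the zeroth order valid
    for all orders. *)
Fixpoint dilation_diff (R : realType) (psi : R -> R) (c q : nat -> R)
    (m n : nat) (x : R) : R :=
  if n is n'.+1 then
    dilation_diff psi c q m n' x
      - c n' * (q n')^-1 ^+ m * dilation_diff psi c q m n' ((q n')^-1 * x)
  else derive1n m psi x.

Definition dilation_limit (R : realType) (psi : R -> R) (c q : nat -> R)
    (m : nat) (x : R) : R :=
  limn (fun n => dilation_diff psi c q m n x).

Section dilation.
Context {R : realType}.
Variables (psi : R -> R) (c q : nat -> R) (dl : R).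
Hypothesis psi_smooth : forall n, bounded_diff n psi.
Hypothesis q_ge1 : forall n, 1 <= q n.
Hypothesis c_ge0 : forall n, 0 <= c n.
Hypothesis c_le : forall n, c n <= dl * 2^-1 ^+ n.+2.
Hypothesis dl_le1 : dl <= 1.

Local Notation u := (dilation_diff psi c q).
Local Notation U := (dilation_limit psi c q).

Let is_derive_u m n (x : R) : is_derive x 1 (u m n) (u m.+1 n x).
Proof.
elim: n x => [|n IH] x; first exact/smooth_is_derive/bounded_diff_smooth.
rewrite /=.
have d2 : is_derive x 1 (fun x => u m n ((q n)^-1 * x))
    ((q n)^-1 * u m.+1 n ((q n)^-1 * x)).
  have := @is_derive_affine _ _ _ (q n)^-1 0 x IH.
  by under eq_fun do rewrite addr0; rewrite addr0.
have dZ := is_deriveZ (c n * (q n)^-1 ^+ m) d2.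
have := is_deriveB (IH x) dZ.
by rewrite /GRing.scale/= exprSr !mulrA.
Qed.

Let coef_le m n : `|c n * (q n)^-1 ^+ m| <= dl * 2^-1 ^+ n.+2.
Proof.
have q0 : 0 < q n by apply: lt_le_trans (q_ge1 n).
have qm0 : 0 <= (q n)^-1 ^+ m by rewrite exprn_ge0 ?invr_ge0 ?(ltW q0).
have qm1 : (q n)^-1 ^+ m <= 1.
  by rewrite exprn_ile1 ?invr_ge0 ?(ltW q0)// invf_le1.
rewrite ger0_norm ?mulr_ge0//.
by apply: le_trans (c_le n); rewrite ler_piMr.
Qed.

(** The factors 1 + c_i have a bounded product since the c_i are summable;
    2 - 2^-n is a convenient closed form for a majorant of this product. *)
Lemma dilation_diff_bound m B : (forall x, `|u m 0 x| <= B) ->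
  forall n x, `|u m n x| <= B * (2 - 2^-1 ^+ n).
Proof.
move=> HB; have B0 : 0 <= B by apply: le_trans (HB 0).
elim=> [|n IH] x.
  by rewrite expr0 (_ : 2 - 1 = 1 :> R) ?mulr1//; ring.
have h0 : 0 <= 2^-1 ^+ n :> R by rewrite exprn_ge0// invr_ge0.
rewrite /=; apply: (le_trans (ler_normB _ _)).
have cq : `|c n * (q n)^-1 ^+ m| <= 2^-1 ^+ n.+2.
  by apply: (le_trans (coef_le m n)); rewrite ler_piMl// exprn_ge0// invr_ge0.
rewrite normrM.
have := lerD (IH x) (ler_pM (normr_ge0 _) (normr_ge0 _) cq (IH ((q n)^-1 * x))).
move=> H; apply: le_trans H _.
rewrite 2!exprS; set h := 2^-1 ^+ n in h0 *.
have -> : B * (2 - h) + 2^-1 * (2^-1 * h) * (B * (2 - h)) =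
  B * (2 - 2^-1 * h) - B * (h * h) / 4 by field.
by rewrite gerBl// divr_ge0// mulr_ge0// mulr_ge0.
Qed.

Lemma dilation_diff_step m B : (forall x, `|u m 0 x| <= B) ->
  forall n x, `|u m n.+1 x - u m n x| <= (dl * B) * 2^-1 ^+ n.+1.
Proof.
move=> HB n x; have B0 : 0 <= B by apply: le_trans (HB 0).
rewrite /= addrC addKr normrN normrM.
have uB : `|u m n ((q n)^-1 * x)| <= B * 2.
  apply: (le_trans (dilation_diff_bound HB _ _)).
  by rewrite ler_wpM2l// lerBlDr lerDl.
apply: (le_trans (ler_pM (normr_ge0 _) (normr_ge0 _) (coef_le m n) uB)).
by rewrite (exprS _ n.+1) le_eqVlt; apply/orP; left; apply/eqP; field.
Qed.

Let derivative_bound m : exists B, forall x, `|u m 0 x| <= B.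
Proof.
have /(_ 0%N) := bounded_diff_derive1n m psi_smooth.
exact: bounded_diff_bound.
Qed.

Lemma dilation_diff_cvg m x : u m n x @[n --> \oo] --> U m x.
Proof.
have [B HB] := derivative_bound m.
by case: (cvg_halving (fun n => dilation_diff_step HB n x)).
Qed.

(** Taking [dl] small keeps the limit close to [psi], hence nonzero. *)
Lemma dilation_limit_dist m B x : (forall x, `|u m 0 x| <= B) ->
  `|U m x - u m 0 x| <= dl * B.
Proof. by move=> HB; case: (cvg_halving (fun n => dilation_diff_step HB n x)). Qed.

Lemma dilation_limit_derive m (x : R) : is_derive x 1 (U m) (U m.+1 x).
Proof.
have [B HB] := derivative_bound m.+2.
apply: (@is_derive_lim _ (u m) (u m.+1) (u m.+2) _ _ (B * 2)).
- by move=> n y; exact: is_derive_u.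
- by move=> n y; exact: is_derive_u.
- move=> n y; apply: (le_trans (dilation_diff_bound HB _ _)).
  rewrite ler_wpM2l//; first by apply: le_trans (HB 0).
  by rewrite lerBlDr lerDl exprn_ge0// invr_ge0.
- by move=> y; exact: dilation_diff_cvg.
- by move=> y; exact: dilation_diff_cvg.
Qed.

Lemma dilation_diff_continuous n : continuous (u 0 n).
Proof. by apply: derivable_continuous => x; exact: is_derive_u. Qed.

End dilation.

(** * Moments of compactly supported functions *)

(** [M] is the k-th moment of [f], for [f] vanishing outside [a, b]: it is the
    total increment of a primitive of x^k f(x). Phrased with primitives, the
    effect of a dilation on moments is an algebraic identity rather than a change
    of variable in an integral. *)
Definition moment_primitive (R : realType) (k : nat) (f : R -> R) (a b M : R)
    (P : R -> R) :=
  [/\ forall x : R, is_derive x 1 P (x ^+ k * f x),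
      forall x, x <= a -> P x = 0
    & forall x, b <= x -> P x = M].

Section moment_primitive.
Context {R : realType}.
Notation mu := (@lebesgue_measure R).
Implicit Types (f P : R -> R) (k : nat) (a b c q M : R).

Lemma continuous_moment k f : continuous f -> continuous (fun x : R => x ^+ k * f x).
Proof.
move=> cf x.
apply: (@cvgM R R (nbhs x) _ (fun x : R => x ^+ k) f); last exact: cf.
exact: exprn_continuous.
Qed.

(** The k-th moment of f(x / q) is q^(k+1) times that of [f], hence the choice
    c = q^-(k+1) makes the k-th moment vanish, while a moment that is already zero
    remains so for every [c]. *)
Lemma moment_primitive_dilate k f a b c q M P : 0 <= a -> 0 <= b -> 1 <= q ->
  moment_primitive k f a b M P ->
  moment_primitive k (fun x => f x - c * f (q^-1 * x)) a (q * b)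
    (M * (1 - c * q ^+ k.+1)) (fun x => P x - c * q ^+ k.+1 * P (q^-1 * x)).
Proof.
move=> a0 b0 q1 [dP P0 PM].
have q0 : 0 < q by apply: lt_le_trans q1.
split=> [x|x xa|x bx].
- have d2 : is_derive x 1 (fun x => P (q^-1 * x))
      (q^-1 * ((q^-1 * x) ^+ k * f (q^-1 * x))).
    have := @is_derive_affine _ _ _ q^-1 0 x dP.
    by under eq_fun do rewrite addr0; rewrite addr0.
  have := is_deriveB (dP x) (is_deriveZ (c * q ^+ k.+1) d2).
  have -> // : x ^+ k * f x -
      c * q ^+ k.+1 *: (q^-1 * ((q^-1 * x) ^+ k * f (q^-1 * x))) =
      x ^+ k * (f x - c * f (q^-1 * x)).
  rewrite /GRing.scale/= exprMn exprS exprVn; field.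
  by rewrite expf_neq0// gt_eqF.
- rewrite !P0 ?mulr0 ?subrr//.
  case: (leP 0 x) => x0; last first.
    by apply: le_trans a0; rewrite pmulr_rle0 ?invr_gt0// ltW.
  by apply: le_trans xa; rewrite ler_piMl// invf_le1.
- rewrite !PM ?ler_pdivlMl//; first by ring.
  by apply: le_trans bx; rewrite ler_peMl.
Qed.

Lemma integral_moment_primitive k f a b (a' b' : R) M P :
  a < b -> a <= a' -> b' <= b -> continuous f -> moment_primitive k f a' b' M P ->
  (\int[mu]_(x in `[a, b]) (x ^+ k * f x)%:E = M%:E)%E.
Proof.
move=> ab aa bb cf [dP P0 PM].
rewrite (@continuous_FTC2 _ _ P)//.
- by rewrite (PM b bb) (P0 a aa) sube0.
- by apply: continuous_subspaceT; exact: continuous_moment.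
- have cP := derivable_continuous dP.
  split=> [x _||].
  + exact: (@ex_derive _ _ _ _ _ _ _ (dP x)).
  + by apply: cvg_at_right_filter; exact: cP.
  + by apply: cvg_at_left_filter; exact: cP.
- by move=> x _; rewrite derive1E; exact: (@derive_val _ _ _ _ _ _ _ (dP x)).
Qed.

(** Dominated convergence on the compact interval. *)
Lemma integral_moment_lim k (F : nat -> R -> R) f (a b K : R) N :
  (forall n, continuous (F n)) -> continuous f ->
  (forall n x, `|F n x| <= K) ->
  (forall x, F n x @[n --> \oo] --> f x) ->
  (forall n, (N <= n)%N -> \int[mu]_(x in `[a, b]) (x ^+ k * F n x)%:E = 0)%E ->
  (\int[mu]_(x in `[a, b]) (x ^+ k * f x)%:E = 0)%E.
Proof.
move=> cF cf FK Ff F0.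
have mX (g : R -> R) : continuous g ->
    measurable_fun (`[a, b]%classic : set R) (fun x : R => (x ^+ k * g x)%:E).
  move=> cg; apply/measurable_EFinP; apply: measurable_funTS.
  by apply: continuous_measurable_fun; exact: continuous_moment.
have [] := @dominated_convergence _ _ _ mu `[a, b] (measurable_itv _)
  (fun n x => (x ^+ k * F n x)%:E) (fun x => (x ^+ k * f x)%:E)
  (fun x => (`|x ^+ k| * K)%:E).
- by move=> n; exact: mX.
- exact: mX.
- apply: aeW => x _; apply: cvg_EFin; first by apply: nearW => n.
  by apply: cvgM; [exact: cvg_cst|exact: Ff].
- apply: continuous_compact_integrable; first exact: segment_compact.
  apply: continuous_subspaceT => x.
  apply: (@cvgM R R (nbhs x) _ (fun x : R => `|x ^+ k|) (cst K));
    last exact: cvg_cst.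
  by apply: cvg_norm; exact: exprn_continuous.
- by apply: aeW => x n _; rewrite lee_fin normrM ler_wpM2l.
move=> _ _ cv.
rewrite -(cvg_lim _ cv)//; apply/cvg_lim => //; apply: cvg_near_cst.
by exists N => // n /= Nn; apply: F0.
Qed.

Lemma moment_primitive_exists k f a b : a < b ->
  continuous f -> (forall x, x <= a -> f x = 0) -> (forall x, b <= x -> f x = 0) ->
  exists M P, moment_primitive k f a b M P.
Proof.
move=> ab cf fa fb.
pose g x := x ^+ k * f x.
have cg : continuous g by exact: continuous_moment.
have gE : g = g \_ `[a, b].
  apply/funext => x; rewrite patchE; case: ifPn => //.
  rewrite notin_setE/= in_itv/= => /negP; rewrite negb_and -!ltNge => /orP[] /ltW xx.
    by rewrite /g fa ?mulr0.
  by rewrite /g fb ?mulr0.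
have ig : mu.-integrable setT (EFin \o g).
  rewrite gE -restrict_EFin; apply/(integrable_mkcond _ _).1 => //.
  apply: continuous_compact_integrable; first exact: segment_compact.
  exact: continuous_subspaceT.
pose P (x : R) := (\int[mu]_(t in [set` Interval -oo%O (BRight x)]) g t)%R.
exists (P b), P; split=> [x|x xa|x bx].
- have [|||dP eP] := @continuous_FTC1 _ g -oo%O x (x + 1) _ _ _ (cg x).
  + by rewrite ltrDl.
  + by apply: integrableS ig.
  + by rewrite ltNyr.
  by apply: DeriveDef => //; rewrite -derive1E.
- rewrite /P (@eq_Rintegral _ _ _ _ _ (cst 0)) ?Rintegral_cst// ?mul0r//.
  move=> t; rewrite inE/= in_itv/= => tx.
  by rewrite /g fa ?mulr0// (le_trans tx).
- rewrite /P Rintegral_mkcond [RHS]Rintegral_mkcond; apply: eq_Rintegral => t _.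
  rewrite !patchE; case: (leP t b) => tb.
    by rewrite !mem_set//= in_itv/= ?tb ?(le_trans tb).
  rewrite (memNset (A := `]-oo, b]%classic)) /=; last by rewrite in_itv/= leNgt tb.
  by case: ifP => // _; rewrite /g fb ?mulr0// ltW.
Qed.

End moment_primitive.

(** * Probability measures given by a density *)

(** The proofs of positivity, measurability and normalization are arguments so
    that the probability structure can be attached to the definition itself. *)
Definition density_measure (R : realType) (f : R -> R)
    (f_ge0 : forall x, 0 <= f x) (mf : measurable_fun [set: R] f)
    (f1 : (\int[lebesgue_measure]_x (f x)%:E = 1)%E)
    (A : set (measurableTypeR R)) : \bar R :=
  (\int[lebesgue_measure]_(x in A) (f x)%:E)%E.

Section density_measure.
Context {R : realType}.
Local Open Scope ereal_scope.
Notation mu := (@lebesgue_measure R).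
Variable f : R -> R.
Hypothesis f_ge0 : forall x, (0 <= f x)%R.
Hypothesis mf : measurable_fun [set: R] f.
Hypothesis f1 : \int[mu]_x (f x)%:E = 1.

Local Notation nu := (density_measure f_ge0 mf f1).

Let mEf (A : set R) : measurable_fun A (EFin \o f).
Proof. exact/measurable_EFinP/measurable_funTS. Qed.

Let nu0 : nu set0 = 0. Proof. exact: integral_set0. Qed.

Let nu_ge0 A : 0 <= nu A.
Proof. by apply: integral_ge0 => x _; rewrite lee_fin. Qed.

Let nu_sigma_additive : semi_sigma_additive nu.
Proof.
move=> /= F mF tF mUF; rewrite /density_measure; apply: cvg_toP.
  apply: ereal_nondecreasing_is_cvgn => m n mn.
  apply: lee_sum_nneg_natr => // k _ _; apply: integral_ge0 => /= x Fkx.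
  by rewrite lee_fin.
rewrite ge0_integral_bigcup//=.
- exact: mEf.
- by move=> x _; rewrite lee_fin.
Qed.

HB.instance Definition _ := isMeasure.Build _ _ _
  nu nu0 nu_ge0 nu_sigma_additive.

HB.instance Definition _ := @Measure_isProbability.Build _ _ R nu f1.

Lemma density_measureE : has_density nu f.
Proof. by []. Qed.

Lemma density_measure_dominates : nu `<< mu.
Proof.
apply/null_content_dominatesP => A mA muA0.
by apply: null_set_integral => //; exact: mEf.
Qed.

(** By uniqueness, [f] is almost everywhere the Radon-Nikodym derivative of the
    measure it defines, for which the change of measure is known. *)
Lemma integral_density_measure (D : set (measurableTypeR R)) (g : R -> \bar R) :
  (forall x, 0 <= g x) -> measurable D -> measurable_fun [set: R] g ->
  \int[nu]_(x in D) g x = \int[mu]_(x in D) (g x * (f x)%:E).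
Proof.
move=> g0 mD mg.
have numu := density_measure_dominates.
pose rn := Radon_Nikodym_SigmaFinite.f nu mu.
have irn : mu.-integrable setT rn := Radon_Nikodym_SigmaFinite.f_integrable numu.
rewrite -(Radon_Nikodym_SigmaFinite.change_of_variables numu)//;
  last exact: measurable_funTS.
apply: ge0_ae_eq_integral => //.
- apply: emeasurable_funM; first exact: measurable_funTS.
  exact/measurable_funTS/measurable_int/irn.
- by apply: emeasurable_funM; [exact: measurable_funTS|exact: mEf].
- by move=> x _; rewrite mule_ge0// Radon_Nikodym_SigmaFinite.f_ge0.
- by move=> x _; rewrite mule_ge0// lee_fin.
apply: ae_eqe_mul2l; apply: (@ae_eq_subset _ _ _ _ mu setT) => //.
apply: integral_ae_eq => //; first exact: mEf.
move=> E _ mE; rewrite -/rn -Radon_Nikodym_SigmaFinite.f_integral//.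
Qed.

End density_measure.

Lemma integral_open_gt0 (R : realType) (f : R -> R) (U : set R) (x : R) :
  continuous f -> open U -> (forall y, U y -> 0 <= f y) -> U x -> 0 < f x ->
  (0 < \int[lebesgue_measure]_(y in U) (f y)%:E)%E.
Proof.
move=> cf oU f0 Ux fx.
have [r /= r0 rU] : exists2 r : R, 0 < r &
    ball x r `<=` U `&` [set y | f x / 2 < f y].
  have : nbhs x (U `&` [set y | f x / 2 < f y]).
    apply: filterI; first exact: open_nbhs_nbhs.
    by apply: (cvgr_gt _ (cf x)); rewrite ltr_pdivrMr// ltr_pMr// ltr1n.
  by move=> /nbhs_ballP[r r0 ?]; exists r.
have mU : measurable (U : set (measurableTypeR R)) by exact: open_measurable.
have mf A : measurable_fun A (EFin \o f).
  by apply/measurable_EFinP/measurable_funTS; exact: continuous_measurable_fun.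
apply: (@lt_le_trans _ _ (\int[lebesgue_measure]_(y in ball x r) (f x / 2)%:E)%E).
  rewrite integral_cst; last exact: measurable_ball.
  rewrite [X in (_ * X)%E](lebesgue_measure_ball _ (ltW r0)).
  by rewrite -EFinM lte_fin mulr_gt0 ?divr_gt0// mulrn_wgt0.
apply: (@le_trans _ _ (\int[lebesgue_measure]_(y in ball x r) (f y)%:E)%E).
  apply: ge0_le_integral => //.
  - exact: measurable_ball.
  - by move=> y _; rewrite lee_fin divr_ge0// ltW.
  - exact: mf.
  - by move=> y /rU[_ /ltW].
apply: ge0_subset_integral => //.
- exact: measurable_ball.
- exact: mf.
- by move=> y /rU[].
Qed.

(** * A smooth function with infinitely many vanishing moments *)

(** The seed of the construction is the derivative of a bump function rather
    than the bump itself: its integral is zero, and this is what keeps the total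
    mass unchanged by the perturbation. *)
Definition bump_derivative (R : realType) (a b x : R) : R :=
  flat 2 (x - a) * flat 0 (b - x) - flat 0 (x - a) * flat 2 (b - x).

Section bump_derivative.
Context {R : realType}.
Implicit Types a b x : R.

Lemma is_derive_bump a b x : is_derive x 1 (bump a b) (bump_derivative a b x).
Proof.
have d1 : is_derive x 1 (fun y => flat 0 (y - a)) (flat 2 (x - a)).
  have := @is_derive_affine _ _ _ 1 (- a) x (@is_derive_flat R 0).
  under eq_fun do rewrite mul1r.
  by rewrite !mul1r mul0r subr0.
have d2 : is_derive x 1 (fun y => flat 0 (b - y)) (- flat 2 (b - x)).
  have := @is_derive_affine _ _ _ (-1) b x (@is_derive_flat R 0).
  under eq_fun do rewrite mulN1r addrC.
  by rewrite !mulN1r mul0r subr0 (addrC _ b).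
have := is_deriveM d1 d2.
by rewrite /GRing.scale/= mulrN addrC (mulrC (flat 0 (b - x))).
Qed.

Lemma bounded_diff_bump_derivative a b n : bounded_diff n (bump_derivative a b).
Proof.
have A k : bounded_diff n (fun x => flat k (x - a)).
  by have := @bounded_diff_affine _ n _ 1 (- a) (@bounded_diff_flat R n k);
    under eq_fun do rewrite mul1r.
have B k : bounded_diff n (fun x => flat k (b - x)).
  by have := @bounded_diff_affine _ n _ (-1) b (@bounded_diff_flat R n k);
    under eq_fun do rewrite mulN1r addrC.
have := bounded_diffD (bounded_diffM (A 2%N) (B 0%N))
  (bounded_diffZ (-1) (bounded_diffM (A 0%N) (B 2%N))).
congr bounded_diff; apply/funext => x /=.
by rewrite mulN1r.
Qed.

Lemma bump_derivative_left a b x : x <= a -> bump_derivative a b x = 0.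
Proof.
move=> xa; rewrite /bump_derivative !(@flat_le0 _ _ (x - a)) ?subr_le0//.
by rewrite !mul0r subrr.
Qed.

Lemma bump_derivative_right a b x : b <= x -> bump_derivative a b x = 0.
Proof.
move=> bx; rewrite /bump_derivative !(@flat_le0 _ _ (b - x)) ?subr_le0//.
by rewrite !mulr0 subrr.
Qed.

Lemma bump_derivative_gt0 a b : a < b -> exists x, 0 < bump_derivative a b x.
Proof.
move=> ab.
have am : a < (a + b) / 2 by lra.
have mb : (a + b) / 2 < b by lra.
have [|c _ E] := MVT am (fun x _ => is_derive_bump a b x).
  by apply: continuous_subspaceT; apply: derivable_continuous; exact: is_derive_bump.
exists c; move: E; rewrite (@bump_left _ a b a)// subr0 => E.
have := bump_gt0 am mb; rewrite E pmulr_lgt0// subr_gt0//.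
Qed.

Lemma moment_primitive_bump a b :
  moment_primitive 0 (bump_derivative a b) a b 0 (bump a b).
Proof.
split=> [x|x|x]; [|exact: bump_left|exact: bump_right].
by rewrite expr0 mul1r; exact: is_derive_bump.
Qed.

End bump_derivative.

Lemma infinite_set_nat (S : set nat) :
  (forall n, exists2 k, (n <= k)%N & S k) -> infinite_set S.
Proof.
move=> H /finite_seqP[s sE].
have [k + Sk] := H (\max_(i <- s) i).+1.
move: Sk; rewrite sE /= => ks.
by rewrite ltnNge (leq_bigmax_seq _ (F := fun i => i)).
Qed.

(** However close to 1 the ratio [q] is, a large exponent makes q^-(k+1) small:
    the dilations can be as mild as the support requires, and the coefficients
    as small as convergence requires, at the price of going far in the moments. *)
Lemma small_power (R : realType) (q e : R) (N : nat) : 1 < q -> 0 < e ->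
  exists2 k, (N <= k)%N & q^-1 ^+ k.+1 <= e.
Proof.
move=> q1 e0; have q0 : 0 < q by apply: lt_trans q1.
have c0 : q^-1 ^+ n @[n --> \oo] --> (0 : R).
  by apply: cvg_expr; rewrite ger0_norm ?invr_ge0 ?(ltW q0)// invf_lt1.
have [M _ HM] : \forall n \near \oo, q^-1 ^+ n <= e.
  by apply: (cvgr_le _ c0).
exists (maxn N M); first exact: leq_maxl.
by apply: HM; rewrite /= ltnW// ltnS leq_maxr.
Qed.

Section vanishing_moments.
Context {R : realType}.
Variables (a b : R) (psi : R -> R) (c q B : nat -> R).
Hypothesis a0 : 0 <= a.
Hypothesis B0 : forall n, 0 <= B n.
Hypothesis q1 : forall n, 1 <= q n.
Hypothesis Bq : forall n, B n.+1 = q n * B n.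
Local Notation u := (dilation_diff psi c q 0).

Lemma dilation_diff_primitiveS k n M P :
  moment_primitive k (u n) a (B n) M P ->
  moment_primitive k (u n.+1) a (B n.+1) (M * (1 - c n * q n ^+ k.+1))
    (fun x => P x - c n * q n ^+ k.+1 * P ((q n)^-1 * x)).
Proof.
move=> /(moment_primitive_dilate (c n) a0 (B0 n) (q1 n)).
rewrite -Bq; set f := fun x => _.
suff -> : f = u n.+1 by [].
by apply/funext => x; rewrite /f /= expr0 mulr1.
Qed.

Lemma dilation_diff_primitive0 k m n P : (m <= n)%N ->
  moment_primitive k (u m) a (B m) 0 P ->
  exists P', moment_primitive k (u n) a (B n) 0 P'.
Proof.
move=> mn H; rewrite -(subnKC mn).
elim: (n - m)%N => [|d [Q HQ]]; first by exists P; rewrite addn0.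
by have := dilation_diff_primitiveS HQ; rewrite mul0r -addnS; eexists; eassumption.
Qed.

Lemma dilation_diff_left n x : (forall x, x <= a -> psi x = 0) ->
  x <= a -> u n x = 0.
Proof.
move=> H; elim: n x => [|n IH] x xa; first exact: H.
have q0 : 0 < q n by apply: lt_le_trans (q1 n).
rewrite /= !IH ?mulr0 ?subrr//.
case: (leP 0 x) => x0; last first.
  by apply: le_trans a0; rewrite pmulr_rle0 ?invr_gt0// ltW.
by apply: le_trans xa; rewrite ler_piMl// invf_le1.
Qed.

Lemma dilation_diff_right n x : (forall x, B 0%N <= x -> psi x = 0) ->
  B n <= x -> u n x = 0.
Proof.
move=> H; elim: n x => [|n IH] x xa; first exact: H.
have q0 : 0 < q n by apply: lt_le_trans (q1 n).
move: xa; rewrite Bq => xa.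
rewrite /= !IH ?mulr0 ?subrr// ?ler_pdivlMl//.
by apply: le_trans xa; rewrite ler_peMl.
Qed.

End vanishing_moments.

(** The points B_n increase from the middle of [a, b] towards b and the ratios
    q_n = B_(n+1) / B_n therefore keep all supports inside [a, b]. The exponent k_n
    is taken so large that c_n = q_n^-(k_n+1) is at most dl 2^-(n+2); step n then
    kills the moment of order k_n, later steps preserve this, and the limit
    inherits it. *)
Lemma smooth_vanishing_moments (R : realType) (a b : R) : 0 < a -> a < b ->
  exists h : R -> R,
    [/\ smooth h, (exists K : R, forall x, `|h x| <= K),
        (forall x, x <= a -> h x = 0) /\ (forall x, b <= x -> h x = 0),
        exists x, 0 < h x
      & forall a' b', a' <= a -> b <= b' ->
        let S := [set k : nat |
          (\int[lebesgue_measure]_(x in `[a', b']) (x ^+ k * h x)%:E = 0)%E] in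
        S 0%N /\ infinite_set S].
Proof.
move=> a0 ab.
pose be := (a + b) / 2.
have abe : a < be by rewrite /be; lra.
have beb : be < b by rewrite /be; lra.
pose psi := bump_derivative a be.
have psi_smooth n : bounded_diff n psi by exact: bounded_diff_bump_derivative.
have [K HK] := bounded_diff_bound (psi_smooth 0%N).
have [x0 px0] : exists x, 0 < psi x by exact: bump_derivative_gt0.
have pK : psi x0 <= K by apply: le_trans (ler_norm _) (HK _).
have K0 : 0 < K by apply: lt_le_trans pK.
(* small enough for the limit to remain positive at x0 *)
pose dl := psi x0 / (2 * K).
have dl0 : 0 < dl by rewrite divr_gt0// mulr_gt0.
have dl1 : dl <= 1 by rewrite ler_pdivrMr ?mulr_gt0//; lra.
have dlK : dl * K < psi x0.
  by rewrite /dl invfM mulrA mulfVK ?gt_eqF// ltr_pdivrMr// ltr_pMr// ltr1n.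
pose B n := b - (b - be) * 2^-1 ^+ n.
have hn n : 0 < 2^-1 ^+ n :> R by rewrite exprn_gt0// invr_gt0.
have hn1 n : 2^-1 ^+ n <= 1 :> R.
  by rewrite exprn_ile1// ?invr_ge0// invf_le1// ler1n.
have B0 : B 0%N = be by rewrite /B expr0; ring.
have Bb n : B n <= b by rewrite /B gerBl// mulr_ge0 ?(ltW (hn _))// subr_ge0 ltW.
have Bgt n : 0 < B n.
  apply: (@lt_le_trans _ _ be); first by apply: lt_trans abe.
  by rewrite /B lerBrDl -lerBrDr ler_piMr// subr_ge0 ltW//.
have BS n : B n < B n.+1.
  by rewrite /B ltrD2l ltrN2 ltr_pM2l ?subr_gt0// exprS gtr_pMl// invf_lt1// ltr1n.
pose q n := B n.+1 / B n.
have q1 n : 1 < q n by rewrite ltr_pdivlMr ?mul1r.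
have Bq n : B n.+1 = q n * B n by rewrite /q divfK// gt_eqF.
have /choice[kk Hkk] n : exists k,
    (n <= k)%N /\ (q n)^-1 ^+ k.+1 <= dl * 2^-1 ^+ n.+2.
  by have [|k] := @small_power _ (q n) (dl * 2^-1 ^+ n.+2) n (q1 n);
    [rewrite mulr_gt0|exists k].
pose c n := (q n)^-1 ^+ (kk n).+1.
have q0 n : 0 < q n by apply: lt_trans (q1 n).
have c0 n : 0 <= c n by rewrite exprn_ge0// invr_ge0 ltW.
have cle n : c n <= dl * 2^-1 ^+ n.+2 by case: (Hkk n).
have q1' n : 1 <= q n by exact: ltW.
have B0' n : 0 <= B n by exact: ltW.
have a0' := ltW a0.
pose u := dilation_diff psi c q 0.
pose U := dilation_limit psi c q.
have uU x : u n x @[n --> \oo] --> U 0%N x.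
  exact: (dilation_diff_cvg psi_smooth q1' c0 cle dl1).
have dU m (x : R) : is_derive x 1 (U m) (U m.+1 x).
  exact: (dilation_limit_derive psi_smooth q1' c0 cle dl1).
have uK n x : `|u n x| <= K * 2.
  apply: (le_trans (dilation_diff_bound q1' c0 cle dl1 (m := 0) HK _ _)).
  by rewrite ler_wpM2l ?(ltW K0)// lerBlDr lerDl ltW.
have UK x : `|U 0%N x - psi x| <= dl * K.
  exact: (dilation_limit_dist q1' c0 cle dl1 (m := 0)).
have lim0 x : (forall n, u n x = 0) -> U 0%N x = 0.
  move=> ux; apply/esym; rewrite -[RHS](cvg_lim _ (uU x))//; apply/esym.
  by apply: cvg_lim => //; apply: cvg_near_cst; apply: nearW => n; exact: ux.
exists (U 0%N); split.
- exact: family_smooth.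
- exists (dl * K + K) => x.
  rewrite -[U 0%N x](subrK (psi x)) (le_trans (ler_normD _ _))// lerD//.
- split=> x xx; apply: lim0 => n.
    apply: (dilation_diff_left c a0' q1' n _ xx) => y.
    exact: bump_derivative_left.
  apply: (@dilation_diff_right _ psi c q B) => //.
    by move=> y; rewrite B0; exact: bump_derivative_right.
  by apply: le_trans xx.
- exists x0; have := UK x0; rewrite ler_norml => /andP[+ _]; lra.
- move=> a' b' aa bb S.
  have zero k m P : moment_primitive k (u m) a (B m) 0 P -> S k.
    move=> H; apply: (@integral_moment_lim _ k u _ _ _ (K * 2) m) => //.
    + by move=> n; exact: (dilation_diff_continuous (c := c) (q := q) psi_smooth).
    + exact: derivable_continuous (dU 0%N).
    + move=> n mn.
      have [P' HP'] := dilation_diff_primitive0 a0' B0' q1' Bq mn H.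
      apply: (integral_moment_primitive _ aa _ _ HP').
      * by apply: (le_lt_trans aa); apply: (lt_le_trans ab).
      * by apply: le_trans bb.
      * exact: (dilation_diff_continuous (c := c) (q := q) psi_smooth).
  split.
    apply: (zero 0%N 0%N (bump a be)); rewrite B0; exact: moment_primitive_bump.
  apply: infinite_set_nat => n; exists (kk n); first by case: (Hkk n).
  have [M [P HP]] : exists M P, moment_primitive (kk n) (u n) a (B n) M P.
    apply: moment_primitive_exists.
    + apply: (lt_le_trans abe); rewrite -B0.
      by elim: n => [//|n IH]; apply: le_trans IH (ltW _).
    + exact: (dilation_diff_continuous (c := c) (q := q) psi_smooth).
    + move=> x xa; apply: (dilation_diff_left c a0' q1' n _ xa) => y.
      exact: bump_derivative_left.
    + move=> x xb; apply: (@dilation_diff_right _ psi c q B) => //.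
      by move=> y; rewrite B0; exact: bump_derivative_right.
  have := dilation_diff_primitiveS a0' B0' q1' Bq HP.
  have -> : c n * q n ^+ (kk n).+1 = 1.
    by rewrite /c -exprMn mulVf ?expr1n// gt_eqF.
  by rewrite subrr mulr0 => /zero.
Qed.

(** * Perturbation of a density *)

Lemma integral_vanishing_outside (R : realType) (a b : R) (D : set R) (F : R -> R) :
  `[a, b]%classic `<=` D ->
  (forall x, x <= a -> F x = 0) -> (forall x, b <= x -> F x = 0) ->
  (\int[lebesgue_measure]_(x in D) (F x)%:E =
   \int[lebesgue_measure]_(x in `[a, b]) (F x)%:E)%E.
Proof.
move=> abD Fa Fb; rewrite integral_mkcond [RHS]integral_mkcond.
apply: eq_integral => x _; rewrite !patchE.
case: (boolP (x \in `[a, b]%classic)) => [xab|].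
  by rewrite mem_set//; apply: abD; rewrite inE in xab.
rewrite notin_setE/= in_itv/= => /negP; rewrite negb_and -!ltNge => /orP[] /ltW xx.
  by rewrite Fa//; case: ifP.
by rewrite Fb//; case: ifP.
Qed.

Section compactly_supported_density.
Context {R : realType}.
Variables (a b : R) (f : R -> R).
Hypothesis a0 : 0 < a.
Hypothesis ab : a < b.
Hypothesis cf : continuous f.
Hypothesis f_ge0 : forall x, 0 <= f x.
Hypothesis f_left : forall x, x <= a -> f x = 0.
Hypothesis f_right : forall x, b <= x -> f x = 0.
Hypothesis mf : measurable_fun [set: R] f.
Hypothesis f1 : (\int[lebesgue_measure]_x (f x)%:E = 1)%E.

Local Notation nu := (density_measure f_ge0 mf f1).

Lemma msupport_density : (forall x, a < x -> x < b -> 0 < f x) ->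
  msupport nu = `[a, b]%classic.
Proof.
move=> fgt0; apply/seteqP; split=> x /=.
- move=> /(_ (~` `[a, b]%classic)) H; apply: contrapT => nx.
  have oC : open (~` (`[a, b]%classic : set R)).
    by apply: closed_openC; exact: interval_closed.
  have := H oC nx.
  rewrite /= /density_measure integral0_eq ?ltxx// => y /=.
  move=> /negP; rewrite in_itv/= negb_and -!ltNge => /orP[] /ltW yy.
    by rewrite f_left.
  by rewrite f_right.
- rewrite in_itv/= => /andP[ax xb] U oU Ux.
  have [y Uy /andP[ay yb]] : exists2 y, U y & a < y < b.
    have /nbhs_ballP[r /= r0 rU] : nbhs x U by exact: open_nbhs_nbhs.
    have small (d : R) : 0 < d -> exists w : R, [/\ 0 < w, w < r & w < d].
      move=> d0; exists (Num.min r d / 2).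
      have w0 : 0 < Num.min r d by rewrite lt_min r0.
      have w2 : Num.min r d / 2 < Num.min r d.
        by rewrite ltr_pdivrMr// ltr_pMr// ltr1n.
      by split; [rewrite divr_gt0|rewrite (lt_le_trans w2)// ge_min lexx ?orbT..].
    have near (w y : R) : `|x - y| = w -> w < r -> U y by move=> <- ?; exact: rU.
    case: (ltP x b) => xb'.
    + have [|w [w0 wr wb]] := small (b - x); first by rewrite subr_gt0.
      exists (x + w); last by apply/andP; split; lra.
      apply: (near w) => //; rewrite (_ : x - (x + w) = - w); last ring.
      by rewrite normrN gtr0_norm.
    + have [|w [w0 wr wb]] := small (x - a).
        by rewrite subr_gt0 (lt_le_trans ab).
      exists (x - w); last by apply/andP; split; lra.
      apply: (near w) => //; rewrite (_ : x - (x - w) = w); last ring.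
      by rewrite gtr0_norm.
  apply: (integral_open_gt0 cf oU _ Uy (fgt0 _ ay yb)) => z _; exact: f_ge0.
Qed.

(** Positivity of [a] makes the interval of integration of the moments contain
    the support; the absolute value only serves to have a function that is
    nonnegative on the whole line. *)
Lemma moment_density k :
  moment nu k = (\int[lebesgue_measure]_(x in `[a, b]) (x ^+ k * f x)%:E)%E.
Proof.
rewrite /moment.
transitivity (\int[nu]_(t in `[0%R, +oo[) (`|t| ^+ k)%:E)%E.
  by apply: eq_integral => t; rewrite inE/= in_itv/= andbT => t0; rewrite ger0_norm.
rewrite integral_density_measure//.
- rewrite -(@integral_vanishing_outside _ a b `[0%R, +oo[%classic)//.
  + apply: eq_integral => t; rewrite inE/= in_itv/= andbT => t0.
    by rewrite ger0_norm// EFinM.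
  + move=> x /=; rewrite !in_itv/= andbT => /andP[ax _].
    by apply: le_trans ax; exact: ltW.
  + by move=> x xa; rewrite f_left ?mulr0.
  + by move=> x xa; rewrite f_right ?mulr0.
- by apply/measurable_EFinP; apply: measurable_funX; exact: normr_measurable.
Qed.

End compactly_supported_density.

Lemma integral_moment_perturbation (R : realType) (a b e : R) (k : nat)
    (f h : R -> R) : continuous f -> continuous h ->
  (\int[lebesgue_measure]_(x in `[a, b]) (x ^+ k * (f x + e * h x))%:E =
   \int[lebesgue_measure]_(x in `[a, b]) (x ^+ k * f x)%:E +
   e%:E * \int[lebesgue_measure]_(x in `[a, b]) (x ^+ k * h x)%:E)%E.
Proof.
move=> cf ch.
have int (g : R -> R) : continuous g ->
    lebesgue_measure.-integrable `[a, b] (fun x => (x ^+ k * g x)%:E).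
  move=> cg; apply: continuous_compact_integrable; first exact: segment_compact.
  by apply: continuous_subspaceT; exact: continuous_moment.
rewrite -integralZl//; last exact: int.
rewrite -integralD//; [|exact: int|].
  by apply: eq_integral => x _; rewrite -EFinM -EFinD; congr EFin; ring.
by apply: integrableZl => //; exact: int.
Qed.

Theorem corollary16 (R : realType) (a b : R) (ha : 0 < a) (hab : a < b) :
  exists (mu1 mu2 : probability (measurableTypeR R) R) (f1 f2 : R -> R),
    [/\ exists2 A : set (measurableTypeR R), measurable A & mu1 A <> mu2 A,
        msupport mu1 = `[a, b]%classic /\ msupport mu2 = `[a, b]%classic,
        smooth f1 /\ smooth f2,
        has_density mu1 f1 /\ has_density mu2 f2
      & infinite_set [set k : nat | moment mu1 k = moment mu2 k]].
Proof.
(* room on both sides of the perturbation, where only the bump is present *)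
pose a' := a + (b - a) / 3; pose b' := b - (b - a) / 3.
have aa' : a < a' by rewrite /a'; lra.
have ab' : a' < b' by rewrite /a' /b'; lra.
have bb' : b' < b by rewrite /b'; lra.
have [h [sh [K HK] [ha' hb'] [x0 hx0] hS]] :=
  smooth_vanishing_moments (lt_trans ha aa') ab'.
have {hS} [S0 Sinf] := hS a b (ltW aa') (ltW bb').
have ch := smooth_continuous sh.
pose g := bump a b.
have sg : forall n, bounded_diff n g by exact: bounded_diff_bump.
have cg : continuous g by apply: derivable_continuous; exact: is_derive_bump.
have [Z [P HP]] := @moment_primitive_exists _ 0 _ _ _ hab cg (@bump_left _ a b)
  (@bump_right _ a b).
have intg := integral_moment_primitive hab (lexx a) (lexx b) cg HP.
have gZ : (\int[lebesgue_measure]_x (g x)%:E = Z%:E)%E.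
  rewrite -intg (@integral_vanishing_outside _ a b)//.
  - by apply: eq_integral => x _; rewrite expr0 mul1r.
  - exact: bump_left.
  - exact: bump_right.
have Z0 : 0 < Z.
  rewrite -lte_fin -gZ; apply: (@integral_open_gt0 _ g setT ((a + b) / 2)) => //.
  - exact: openT.
  - by move=> y _; exact: bump_ge0.
  - by apply: bump_gt0; lra.
pose m := flat 0 (a' - a) * flat 0 (b - b').
have m0 : 0 < m by rewrite mulr_gt0// flat_gt0 ?subr_gt0.
have K0 : 0 < K by apply: lt_le_trans (HK x0); rewrite normr_gt0 gt_eqF.
(* e |h| is at most half of the lower bound m / Z of f1 on [a', b'] *)
pose e := Z^-1 * m / (2 * K).
have Zm0 : 0 < Z^-1 * m by rewrite mulr_gt0 ?invr_gt0.
have e0 : 0 < e by apply: divr_gt0 => //; rewrite mulr_gt0.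
pose f1 x := Z^-1 * g x; pose f2 x := f1 x + e * h x.
have f1_ge0 x : 0 <= f1 x by rewrite mulr_ge0 ?invr_ge0 ?bump_ge0// ltW.
have f1_gt0 x : a < x -> x < b -> 0 < f1 x.
  by move=> ax xb; rewrite mulr_gt0 ?invr_gt0 ?bump_gt0.
(* nothing is added outside [a', b'], and the lower bound m / Z rules inside *)
have f2P x : f2 x = f1 x \/ 0 < f2 x.
  case: (leP x a') => xa; first by left; rewrite /f2 ha' ?mulr0 ?addr0.
  case: (leP b' x) => xb; first by left; rewrite /f2 hb' ?mulr0 ?addr0.
  right; have gm : m <= g x by apply: bump_minorant; exact: ltW.
  have : `|e * h x| <= Z^-1 * m / 2.
    rewrite normrM (gtr0_norm e0).
    have -> : Z^-1 * m / 2 = e * K by rewrite /e; field; rewrite !gt_eqF.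
    by rewrite ler_pM2l.
  rewrite ler_norml => /andP[H _].
  have : Z^-1 * m <= f1 x by rewrite ler_pM2l ?invr_gt0.
  by rewrite /f2; lra.
have f2_ge0 x : 0 <= f2 x by case: (f2P x) => [->|/ltW]//.
have f2_gt0 x : a < x -> x < b -> 0 < f2 x.
  by move=> ax xb; case: (f2P x) => [->|//]; exact: f1_gt0.
have f1_left x : x <= a -> f1 x = 0 by move=> xa; rewrite /f1 /g bump_left ?mulr0.
have f1_right x : b <= x -> f1 x = 0 by move=> xb; rewrite /f1 /g bump_right ?mulr0.
have f2_left x : x <= a -> f2 x = 0.
  by move=> xa; rewrite /f2 f1_left// ha' ?mulr0 ?addr0// (le_trans xa)// ltW.
have f2_right x : b <= x -> f2 x = 0.
  by move=> xb; rewrite /f2 f1_right// hb' ?mulr0 ?addr0// (le_trans _ xb)// ltW.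
have s1 : smooth f1 by apply: bounded_diff_smooth => n; exact: bounded_diffZ.
have s2 : smooth f2.
  pose F n x := ((f1^`(n))%classic x + e * (h^`(n))%classic x).
  apply: (family_smooth (F := F)) => n x.
  apply: is_deriveD; first exact: smooth_is_derive.
  by have := is_deriveZ e (smooth_is_derive n x sh).
have c1 := smooth_continuous s1; have c2 := smooth_continuous s2.
have m1 : measurable_fun [set: R] f1 by exact: continuous_measurable_fun.
have m2 : measurable_fun [set: R] f2 by exact: continuous_measurable_fun.
have mass f : (forall x, x <= a -> f x = 0) -> (forall x, b <= x -> f x = 0) ->
    (\int[lebesgue_measure]_x (f x)%:E =
     \int[lebesgue_measure]_(x in `[a, b]) (x ^+ 0 * f x)%:E)%E.
  move=> fa fb; rewrite (@integral_vanishing_outside _ a b)//.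
  by apply: eq_integral => x _; rewrite expr0 mul1r.
have I1 : (\int[lebesgue_measure]_x (f1 x)%:E = 1)%E.
  rewrite /f1; under eq_integral do rewrite EFinM.
  rewrite ge0_integralZl_EFin ?invr_ge0 ?(ltW Z0)//.
  - by rewrite gZ -EFinM mulVf// gt_eqF.
  - by move=> x _; rewrite lee_fin bump_ge0.
  - by apply/measurable_EFinP; exact: continuous_measurable_fun.
have eqk k : (\int[lebesgue_measure]_(x in `[a, b]) (x ^+ k * h x)%:E = 0)%E ->
   (\int[lebesgue_measure]_(x in `[a, b]) (x ^+ k * f2 x)%:E =
    \int[lebesgue_measure]_(x in `[a, b]) (x ^+ k * f1 x)%:E)%E.
  by move=> hk; rewrite integral_moment_perturbation// hk mule0 adde0.
have I2 : (\int[lebesgue_measure]_x (f2 x)%:E = 1)%E.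
  by rewrite mass// eqk// -mass.
exists (density_measure f1_ge0 m1 I1), (density_measure f2_ge0 m2 I2), f1, f2.
split.
- pose U := [set x | 0 < h x].
  have oU : open U.
    apply: (@open_comp _ _ h [set y | 0 < y]); last exact: open_gt.
    by move=> x _; exact: ch.
  have mU : measurable (U : set (measurableTypeR R)) by exact: open_measurable.
  have fin1 : (\int[lebesgue_measure]_(x in U) (f1 x)%:E \is a fin_num)%E.
    exact: (fin_num_measure (density_measure f1_ge0 m1 I1) U mU).
  have ceh : continuous (fun x => e * h x : R).
    by move=> x; apply: cvgM; [exact: cvg_cst|exact: ch].
  have lt12 : (\int[lebesgue_measure]_(x in U) (f1 x)%:E <
      \int[lebesgue_measure]_(x in U) (f2 x)%:E)%E.
    rewrite /f2; under [ltRHS]eq_integral do rewrite EFinD.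
    rewrite ge0_integralD//.
    + rewrite -[ltLHS]adde0 lteD2lE//.
      apply: (integral_open_gt0 (x := x0) ceh oU) => //.
      * by move=> y Uy; rewrite mulr_ge0// ltW.
      * by rewrite mulr_gt0.
    + by move=> x _; rewrite lee_fin.
    + by apply/measurable_EFinP/measurable_funTS.
    + by move=> x Ux; rewrite lee_fin mulr_ge0// ltW.
    + apply/measurable_EFinP; apply: measurable_funTS.
      exact: continuous_measurable_fun ceh.
  by exists U => // E; move: lt12; rewrite [X in (X < _)%E](E : _ = _) ltxx.
- by split; exact: msupport_density.
- by split.
- by split; exact: density_measureE.
- apply: sub_infinite_set Sinf => k Sk /=.
  rewrite (moment_density ha f1_ge0 f1_left f1_right).
  by rewrite (moment_density ha f2_ge0 f2_left f2_right) eqk.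
Qed.
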